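(* Let $X$ be a reflexive, separable Banach space and let $T$ be a bounded linear operator on $X$. Suppose there exist two dense subsets $Y$ and $Z$ of $X$, a sequence $(n_k)_{k\ge 1}$ of positive integers, and a positive integer $M$ such that (1) for every $y\in Y$, $T^{n_k}y\to 0$ weakly in $X$ as $k\to\infty$; (2) for every $y\in Y$ with $\|y\|\le 1$, there is some integer $N$ such that $\sup\{\|T^{n_k}y\| : k\ge N\}\le M$; (3) there exist linear maps $S_k:Z\to X$ ($k\ge 1$) such that for every $z\in Z$, $S_kz\to 0$ and $T^{n_k}S_{n_k}z\to z$ in norm as $k\to\infty$. Then $T$ is weakly hypercyclic.
   Context: The operator $T$ is weakly hypercyclic if there is a vector $x\in X$ whose orbit $\{T^nx:n\ge 0\}$ is dense in $X$ with respect to the weak topology of $X$. The set $Z$ is only assumed to be a dense subset; a map $S:Z\to X$ is called linear if it respects every linear combination of elements of $Z$ that again lies in $Z$. *)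

(* Defs.v *)
From HB Require Import structures.
From mathcomp Require Import all_boot all_order all_algebra.
From mathcomp Require Import all_classical all_reals all_analysis.
From mathcomp Require Import complex.

Set Implicit Arguments.
Unset Strict Implicit.
Unset Printing Implicit Defensive.

Import Order.TTheory GRing.Theory Num.Theory.
Import numFieldNormedType.Exports.

Local Open Scope classical_set_scope.
Local Open Scope ring_scope.

(* A Banach space is a [completeNormedModType K] with K the real or the
   complex field. Norms of a [normedModType K] take their values in K: over the
   complex field they are nonnegative elements of R[i], hence real. *)
Inductive scalars := RealScalars | ComplexScalars.

Definition scalar_field (R : realType) (s : scalars) : numFieldType :=
  Eval cbv [reverse_coercion] in match s with
  | RealScalars => R
  | ComplexScalars => R[i]%C
  end.

Definition separable_space (T : topologicalType) : Prop :=
  exists2 D : set T, countable D & dense D.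

Section Duality.
Variables (K : numFieldType) (X : normedModType K).

Definition dual_space : set (X -> K^o) := [set f | linear f /\ continuous f].

(* The closed unit ball of the dual for the operator norm
   ||f|| = sup {|f x| : ||x|| <= 1}. *)
Definition dual_unit_ball : set (X -> K^o) :=
  [set f | dual_space f /\ forall x : X, `|x| <= 1 -> `|f x| <= 1].

(* The bidual: linear functionals on [dual_space] that are bounded for the
   operator norm. They are represented by total functions, whose values outside
   [dual_space] are irrelevant. *)
Definition bidual : set ((X -> K^o) -> K^o) :=
  [set Phi |
    (forall (a : K) (f g : X -> K^o), dual_space f -> dual_space g ->
       Phi (a *: f + g) = a *: Phi f + Phi g) /\
    (exists C : K, forall f, dual_unit_ball f -> `|Phi f| <= C)].

(* Surjectivity of the canonical map of X into its bidual. *)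
Definition reflexive_space : Prop :=
  forall Phi, bidual Phi -> exists x : X, forall f, dual_space f -> Phi f = f x.

(* X endowed with its weak topology, the coarsest one for which all the elements
   of the dual are continuous. *)
Definition weak_space : Type :=
  sup_topology (fun f : dual_space =>
    Topological.class (initial_topology (\val f : X -> K^o))).

HB.instance Definition _ := Topological.copy weak_space
  (sup_topology (fun f : dual_space =>
    Topological.class (initial_topology (\val f : X -> K^o)))).

Definition bounded_operator (T : X -> X) : Prop :=
  exists C : K, forall x : X, `|T x| <= C * `|x|.

Definition orbit_of (T : X -> X) (x : X) : set X := range (fun n => iter n T x).

Definition weakly_hypercyclic (T : X -> X) : Prop :=
  exists x : X, dense (orbit_of T x : set weak_space).

(* Linearity of a map defined on a mere subset of X. *)
Definition linear_on_subset (Z : set X) (S : Z -> X) : Prop :=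
  forall (m : nat) (a : 'I_m -> K) (z : 'I_m -> Z) (w : Z),
    \val w = \sum_(i < m) a i *: \val (z i) ->
    S w = \sum_(i < m) a i *: S (z i).

End Duality.

Arguments dual_space {K} X _.
Arguments dual_unit_ball {K} X _.
Arguments bidual {K} X _.

(* Main.v *)
Require Import Defs.
From HB Require Import structures.
From mathcomp Require Import all_boot all_order all_algebra.
From mathcomp Require Import all_classical all_reals all_analysis.
From mathcomp Require Import complex ring lra.

Import Order.TTheory GRing.Theory Num.Theory.
Import numFieldNormedType.Exports.

Local Open Scope classical_set_scope.
Local Open Scope ring_scope.

(** Why the theorem holds. The vector [x] is the limit of a sequence [x_i] of
elements of [Y] of norm at most 1. Given [x_i] and a target [v_i], the powers
[T^(n_k)] send [x_i] into the ball of radius [M] and weakly close to 0 for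
large [k]. Choose such an exponent [n_k] and call it [m_(i+1)]; then [x_(i+1)]
is a point of [Y] very near [x_i + S_(m_(i+1)) z], with [z] in [Z] close to
[v_i]. The perturbation is so small that it neither leaves the unit ball nor
disturbs the images under the earlier exponents [m_1, ..., m_i]. Hence
[T^(m_(i+1)) x = T^(m_(i+1)) x_i + v_i + (a norm-small error)]. Because all
[x_i] lie in the unit ball, the bound [M] is the same at each stage, so that
the sequence [T^(m_(i+1)) x - v_i] is bounded, and the exponents may be chosen
so that it tends to 0 along countably many prescribed functionals
([weakly_approximating_orbit]).

Two points make this yield weak density. First, with [v_i] running through a
norm-dense sequence in which each term recurs infinitely often, every term is
the weak limit of a subsequence of the orbit, as soon as convergence to 0 along
the countable family forces weak convergence to 0. That is [bounded_weak_cvg0]: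
an ultrafilter limit of a bounded sequence is a functional on the dual, hence
by reflexivity it is evaluation at a point, which every member of the family
kills; a family that detects all points detected by the dual is enough, and
separability provides a countable one ([countable_dual_family]).

Second, the hypotheses must force [n_k] to tend to infinity, since the
convergence of [S_k z] to 0 is along all [k] but is used along the [n_k]. If
some value [p] recurs infinitely often, then [T^p] vanishes weakly on [Y],
hence weakly everywhere, and the recovery property of the [S_k] makes every
functional vanish on [Z]; the dual is then zero and the weak topology
indiscrete ([times_unbounded_or_zero_dual]). *)

(** * Scalars: small powers of one half and ultrafilter limits *)

Lemma half_expn_lt_real (R : realType) (e : R) :
  0 < e -> \forall i \near \oo, (2^-1 : R) ^+ i < e.
Proof.
move=> e0; have : (2^-1 : R) ^+ i @[i --> \oo] --> 0.
  by apply: cvg_expr; rewrite ger0_norm ?invr_ge0// invf_lt1// ltr1n.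
move=> /cvgr0Pnorm_lt/(_ e e0); apply: filterS => i.
by rewrite ger0_norm // exprn_ge0// invr_ge0.
Qed.

(** The archimedean property, in the form suited to errors that are summed
geometrically. A positive complex number is real, so the complex case reduces to
the real one. *)
Lemma half_expn_lt (R : realType) (s : scalars) (e : scalar_field R s) :
  0 < e -> \forall i \near \oo, (2^-1 : scalar_field R s) ^+ i < e.
Proof.
case: s e => /= e; first exact: half_expn_lt_real.
case: e => a b; rewrite ltcE /= => /andP[/eqP -> a0].
apply: filterS (half_expn_lt_real R a a0) => i.
by rewrite -ltcR rmorphXn /= fmorphV rmorph_nat.
Qed.

(** The image ultrafilter lives on a compact interval, so it has a cluster point,
and a cluster point of an ultrafilter is a limit. *)
Lemma ultra_cvg_real (R : realType) (U : set_system nat) (UU : UltraFilter U)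
    (u : nat -> R) (C : R) :
  (forall i, `|u i| <= C) ->
  exists l, forall e, 0 < e -> U [set i | `|l - u i| < e].
Proof.
move=> uC.
have [] := @segment_compact R (- C) C (u @ U) _ _.
  by apply: (@filterS _ U _ setT) => [i _|]; [rewrite /= in_itv /= -ler_norml|exact: filterT].
move=> l [_ lcl]; exists l => e e0.
have [//|notU] := in_ultra_setVsetC [set i | `|l - u i| < e] UU.
have [z [/= zl]] := lcl (~` ball l e) (ball l e) notU (nbhsx_ballx _ _ e0).
by [].
Qed.

(** Bounded sequences of scalars converge along ultrafilters. Stated with norms in
the scalar field, so that the real and the complex case are used uniformly;
the complex case treats real and imaginary parts separately. *)
Lemma ultra_cvg (R : realType) (s : scalars) (U : set_system nat)
    (UU : UltraFilter U) (u : nat -> scalar_field R s) (C : scalar_field R s) :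
  (forall i, `|u i| <= C) ->
  exists l, forall e, 0 < e -> U [set i | `|l - u i| < e].
Proof.
case: s u C => /= u C; first exact: ultra_cvg_real.
move=> uC.
have normE (z : R[i]%C) : `|complex.Re z| <= complex.Re `|z| /\ `|complex.Im z| <= complex.Re `|z|.
  rewrite normc_def /= -!sqrtr_sqr; split; apply: ler_wsqrtr.
    by rewrite lerDl sqr_ge0.
  by rewrite lerDr sqr_ge0.
have ReC i : complex.Re `|u i| <= complex.Re C.
  by have := uC i; rewrite lecE => /andP[].
have [a aP] := ultra_cvg_real R U UU (fun i => complex.Re (u i)) (complex.Re C)
  (fun i => le_trans (normE _).1 (ReC i)).
have [b bP] := ultra_cvg_real R U UU (fun i => complex.Im (u i)) (complex.Re C)
  (fun i => le_trans (normE _).2 (ReC i)).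
exists (Complex a b) => -[e e']; rewrite ltcE /= => /andP[/eqP -> e0].
have e20 : 0 < e / 2 by rewrite divr_gt0.
apply: filterS (filterI (aP _ e20) (bP _ e20)) => i /= [ai bi].
case: (u i) ai bi => c d /= ac bd.
have -> : Complex a b - Complex c d = Complex (a - c) 0 + Complex 0 (b - d).
  by apply/eqP; rewrite eq_complex /= add0r addr0 !eqxx.
apply: le_lt_trans (ler_normD _ _) _.
rewrite !normc_def /= expr0n /= addr0 add0r !sqrtr_sqr.
rewrite -rmorphD /= ltcR; lra.
Qed.

Lemma half_expn_gt0 (K : numFieldType) i : 0 < (2^-1 : K) ^+ i.
Proof. by rewrite exprn_gt0// invr_gt0. Qed.

Lemma half_expnS (K : numFieldType) i : (2^-1 : K) ^+ i = 2^-1 ^+ i.+1 + 2^-1 ^+ i.+1.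
Proof. by rewrite exprS; field. Qed.

Lemma half_expn_le (K : numFieldType) i j : (i <= j)%N -> (2^-1 : K) ^+ j <= 2^-1 ^+ i.
Proof.
by move=> ij; rewrite ler_wiXn2l ?invr_ge0// invf_le1// ler1n.
Qed.

(** * Continuous functionals and the weak topology *)

Section WeakTopology.
Context {K : numFieldType} {X : normedModType K}.

Lemma weak_cvgP (F : set_system nat) (FF : Filter F) (u : nat -> X) (x : X) :
  ((u k : weak_space X) @[k --> F] --> (x : weak_space X)) <->
  (forall f, dual_space X f -> f (u k) @[k --> F] --> f x).
Proof.
have init_cvg (f : X -> K^o) :
    ((u k : initial_topology f) @[k --> F] --> (x : initial_topology f)) <->
    f (u k) @[k --> F] --> f x.
  split=> [ux|fux].
    apply: (@cvg_comp _ _ _ u f F (nbhs (x : initial_topology f)) _ ux).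
    exact: initial_continuous.
  move=> A; rewrite nbhsE => -[B [[C oC <-] Cx] sub].
  apply: (filterS sub); apply: fux; exact: open_nbhs_nbhs.
split=> [/cvg_sup ux f fd|fux].
  by apply/init_cvg; exact: (ux (SigSub (mem_set fd))).
apply/cvg_sup => -[f /= fd]; by apply/init_cvg; apply: fux; exact: set_mem.
Qed.

Section DualElement.
Variables (f : X -> K^o) (fd : dual_space X f).

Lemma dual_spaceB x y : f (x - y) = f x - f y.
Proof. by have [lf _] := fd; rewrite -scaleN1r addrC lf scaleN1r addrC. Qed.

Lemma dual_space0 : f 0 = 0.
Proof. by rewrite -(subrr 0) dual_spaceB subrr. Qed.

Lemma dual_spaceZ a x : f (a *: x) = a *: f x.
Proof. by have [lf _] := fd; rewrite -[a *: x]addr0 lf dual_space0 addr0. Qed.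

Lemma dual_spaceD x y : f (x + y) = f x + f y.
Proof. by have [lf _] := fd; rewrite -[x]scale1r lf !scale1r. Qed.

End DualElement.

Lemma dual_unit_ball_le f x : dual_unit_ball X f -> `|f x| <= `|x|.
Proof.
move=> [fd f1]; have [->|x0] := eqVneq x 0; first by rewrite (dual_space0 _ fd) !normr0.
have nx0 : 0 < `|x| by rewrite normr_gt0.
have := f1 (`|x|^-1 *: x).
rewrite (dual_spaceZ _ fd) normrZ (normrM _ (f x)) normfV normr_id mulVf ?gt_eqF// => /(_ (lexx _)).
by rewrite mulrC ler_pdivrMr// mul1r.
Qed.

(** Continuity at 0 bounds a functional on a small ball. This reduces statements on
the dual to statements on its unit ball. *)
Lemma dual_space_scaled f : dual_space X f ->
  exists2 d : K, 0 < d & dual_unit_ball X (fun x => d *: f x).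
Proof.
move=> fd; have [lf cf] := fd.
have /nbhs_normP[e /= e0 eP] : \forall x \near (0 : X), `|f x| < 1.
  have := cf 0; rewrite /continuous_at (dual_space0 _ fd).
  by move=> /cvgr0Pnorm_lt/(_ 1 ltr01).
exists (e / 2); first by rewrite divr_gt0.
split; first split.
- by move=> a x y /=; rewrite lf scalerDr !scalerA mulrC.
- move=> x; apply: cvgZl_tmp; exact: cf.
move=> x x1; rewrite -(dual_spaceZ _ fd); apply: ltW; apply: eP => /=.
rewrite sub0r normrN normrZ gtr0_norm ?divr_gt0//.
rewrite (@le_lt_trans _ _ (e / 2 * 1)) // ?ler_wpM2l ?divr_ge0// ?ltW//.
by rewrite mulr1 gtr_pMr // invf_lt1 // ltr1n.
Qed.
End WeakTopology.

(** * Testing weak convergence on a countable family of functionals *)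

Section CountableTesting.
Context {K : numFieldType} {X : normedModType K}.
Hypothesis half_lt : forall e : K, 0 < e -> \forall i \near \oo, (2^-1 : K) ^+ i < e.

Lemma dense_norm_approx (A : set X) (x : X) (e : K) :
  dense A -> 0 < e -> exists2 a, A a & `|a - x| < e.
Proof.
move=> dA e0.
have [||a [/= xa Aa]] := dA (ball x e)^°; last first.
- by exists a => //; move: (interior_subset xa); rewrite -ball_normE /= distrC.
- exact: open_interior.
- by exists x; exact: nbhsx_ballx.
Qed.

Lemma separable_dense_sequence : separable_space X ->
  exists d : nat -> X, forall x e, 0 < e -> exists j, `|d j - x| < e.
Proof.
move=> [D /pfcard_geP[->|[g]] dD].
  by have [y []] := dD setT (ex_intro _ 0 I) openT.
exists g => x e e0; have [y Dy yx] := dense_norm_approx _ x _ dD e0.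
by have [j _ gj] := 'surj_g Dy; exists j; rewrite gj.
Qed.

Lemma dual_unit_ball0 : dual_unit_ball X (fun=> 0).
Proof.
split; first split; first by move=> a x y; rewrite scaler0 addr0.
  exact: cst_continuous.
by move=> x _; rewrite normr0.
Qed.

(** For each term [d m] of the dense sequence and each threshold [2^-j], keep
one functional of the unit ball exceeding the threshold at [d m], if there is
one. Suppose that all the functionals kept vanish at [x]. If some [f] in the
unit ball is nonzero at [x], it exceeds a threshold at a nearby [d m], so the
functional kept there also does; but it vanishes at [x], hence is below the
threshold at [d m]. *)
Lemma countable_dual_family (d : nat -> X)
    (d_dense : forall x e, 0 < e -> exists j, `|d j - x| < e) :
  exists phi : nat -> X -> K^o,
    (forall l, dual_unit_ball X (phi l)) /\
    (forall x, (forall l, phi l x = 0) -> forall f, dual_space X f -> f x = 0).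
Proof.
have /choice[g gP] : forall p : nat * nat, exists g : X -> K^o,
    dual_unit_ball X g /\
    forall f, dual_unit_ball X f -> 2^-1 ^+ p.2 < `|f (d p.1)| ->
    2^-1 ^+ p.2 < `|g (d p.1)|.
  move=> p; have [[h hP]|noh] := pselect (exists h, dual_unit_ball X h /\
      2^-1 ^+ p.2 < `|h (d p.1)|); first by exists h; split => [|f _ _]; [exact: hP.1|exact: hP.2].
  by exists (fun=> 0); split=> [|f fP fd]; [exact: dual_unit_ball0|case: noh; exists f].
exists (fun l => if unpickle l is Some p then g p else fun=> 0); split=> [l|x gx f fd].
  by case: unpickle => [p|]; [exact: (gP p).1|exact: dual_unit_ball0].
have {}gx p : g p x = 0 by have := gx (pickle p); rewrite pickleK.
have [c c0 cf] := dual_space_scaled _ fd.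
apply/eqP/negPn/negP => fx0.
have cfx0 : 0 < `|c * f x| / 2 by rewrite divr_gt0// normr_gt0 mulf_neq0// gt_eqF.
have [j _ /(_ _ (leqnn j)) /= jP] := half_lt _ cfx0.
have [|m mP] := d_dense x (2^-1 ^+ j); first by rewrite exprn_gt0// invr_gt0.
have /= := (gP (m, j)).2 _ cf.
have -> : g (m, j) (d m) = g (m, j) (d m - x).
  by rewrite (dual_spaceB _ (gP _).1.1) gx subr0.
(* [x] and [d m] are closer than [2^-j], and [|c * f x|] is above twice that. *)
have lt1 : 2^-1 ^+ j < `|c * f (d m)|.
  rewrite -(ltrD2r (2^-1 ^+ j)); apply: (@lt_le_trans _ _ `|c * f x|).
    by rewrite [`|c * f x|]splitr ltrD.
  rewrite -(subrK (c * f (d m)) (c * f x)) addrC.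
  apply: le_trans (ler_normD _ _) _; rewrite lerD2l distrC.
  rewrite -(dual_spaceB _ cf.1); apply: le_trans (dual_unit_ball_le _ _ cf) _.
  exact: ltW.
move=> /(_ lt1) lt2.
have := lt_le_trans lt2 (dual_unit_ball_le _ _ (gP _).1).
by move=> /lt_trans/(_ mP); rewrite ltxx.
Qed.

Hypothesis ultra_cvgK : forall (U : set_system nat), UltraFilter U ->
  forall (u : nat -> K) (C : K), (forall i, `|u i| <= C) ->
  exists l, forall e, 0 < e -> U [set i | `|l - u i| < e].

(** If [f (w i)] does not tend to 0, take an ultrafilter [U] that refines the tails
and contains the set of indices where [f (w i)] is large. The limit along [U] is
an element of the bidual, so it is evaluation at some [x] by reflexivity. All
[phi l] vanish at [x], hence so does [f], against the choice of [U]. *)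
Lemma bounded_weak_cvg0 (X_reflexive : reflexive_space X)
    (phi : nat -> X -> K^o)
    (phi_det : forall x, (forall l, phi l x = 0) ->
      forall f, dual_space X f -> f x = 0)
    (phi_dual : forall l, dual_space X (phi l))
    (w : nat -> X) (B : K) (wB : forall i, `|w i| <= B)
    (phiw : forall l, phi l (w i) @[i --> \oo] --> (0 : K^o)) f :
  dual_space X f -> f (w i) @[i --> \oo] --> (0 : K^o).
Proof.
move=> fd; apply/cvgr0Pnorm_lt => e e0; apply: contrapT => nfw.
pose bad := [set i | ~ `|f (w i)| < e].
have pF : ProperFilter (within bad (\oo : set_system nat)).
  split; last exact: within_filter.
  by rewrite /within /= => h; apply: nfw; apply: filterS h => i; exact: contrapT.
have [U [UU subU]] := ultraFilterLemma pF.
have bound g : dual_space X g -> exists C, forall i, `|g (w i)| <= C.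
  move=> gd; have [c c0 cg] := dual_space_scaled _ gd.
  exists (B / c) => i; rewrite ler_pdivlMr// mulrC -[X in X * _]gtr0_norm//.
  rewrite -normrM; exact: le_trans (dual_unit_ball_le _ (w i) cg) (wB i).
have limU g (gd : dual_space X g) :
    exists l : K^o, g (w i) @[i --> U] --> l.
  have [C gC] := bound g gd; have [l lP] := ultra_cvgK U UU _ _ gC.
  by exists l; apply/cvgrPdist_lt => e' e'0; exact: lP.
pose Phi (g : X -> K^o) : K^o := lim (g (w i) @[i --> U]).
have PhiP g l : g (w i) @[i --> U] --> (l : K^o) -> Phi g = l.
  exact: cvg_lim.
have PhiC g : dual_space X g -> g (w i) @[i --> U] --> Phi g.
  by move=> gd; have [l gl] := limU g gd; rewrite (PhiP _ _ gl).
have near0 g : (g (w i) @[i --> \oo] --> (0 : K^o)) -> Phi g = 0.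
  move=> g0; apply: PhiP => A /g0 gA; apply: (subU (fun i => A (g (w i)))).
  exact: (@filterS _ _ _ (fun i => A (g (w i))) _ (fun i gi _ => gi) gA).
have [|x xP] := X_reflexive Phi.
  split=> [a g h gd hd|].
    apply: PhiP; apply: cvgD; last exact: PhiC.
    by apply: cvgZl_tmp; exact: PhiC.
  exists (1 + B) => g gb.
  have /cvgrPdist_lt/(_ 1 ltr01)/filter_ex[i /= gi] := PhiC g gb.1.
  rewrite -(subrK (g (w i)) (Phi g)).
  apply: le_trans (ler_normD _ _) _; apply: lerD; first exact: ltW.
  exact: le_trans (dual_unit_ball_le _ (w i) gb) (wB i).
have fx0 : Phi f = 0.
  rewrite xP//; apply: (phi_det x) => // l.
  by rewrite -xP//; exact: near0.
have Ubad : U bad by apply: subU; apply: nearW.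
have := PhiC f fd; rewrite fx0 => /cvgr0Pnorm_lt/(_ e e0) Ugood.
by have [i [/= ib ig]] := filter_ex (filterI Ubad Ugood).
Qed.
End CountableTesting.

(** * Orbits and weak density *)

Section Orbits.
Context {K : numFieldType} {X : normedModType K}.

Lemma weak_open_meets (O : set (weak_space X)) (u : nat -> X) (x : X) :
  open O -> O x ->
  (forall f, dual_space X f -> f (u k) @[k --> \oo] --> f x) ->
  exists k, O (u k).
Proof.
move=> oO Ox /weak_cvgP ux.
have uO : \forall k \near \oo, O (u k) by apply: ux; exact: open_nbhs_nbhs.
exact: filter_ex uO.
Qed.

Variable T : {linear X -> X}.

Lemma iterB m x y : iter m T (x - y) = iter m T x - iter m T y.
Proof. by elim: m => //= m ->; rewrite linearB. Qed.

(** The constant is taken at least 1 so that its powers increase with the exponent: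
a power then bounds all earlier iterates as well. *)
Lemma bounded_operator_iter : bounded_operator T ->
  exists2 C : K, 1 <= C & forall m x, `|iter m T x| <= C ^+ m * `|x|.
Proof.
move=> [C TC]; exists (1 + `|C|) => [|m x]; first by rewrite lerDl.
have C0 : 0 <= 1 + `|C| by rewrite addr_ge0.
elim: m => [|m IH]; first by rewrite expr0 mul1r.
rewrite iterS exprS -mulrA; apply: le_trans (ler_wpM2l C0 IH).
have Tx := TC (iter m T x).
rewrite mulrDl mul1r ler_wpDl//.
apply: le_trans Tx _; rewrite -(@ger0_norm _ (C * _)) ?normrM ?normr_id//.
exact: le_trans (TC (iter m T x)).
Qed.

(** The weak topology is indiscrete, so the orbit of 0 is dense. *)
Lemma zero_dual_weakly_hypercyclic :
  (forall f, dual_space X f -> forall x, f x = 0) -> weakly_hypercyclic T.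
Proof.
move=> f0; exists 0 => O [p Op] oO.
have [|_ O0] := weak_open_meets _ (fun=> 0) _ oO Op.
  by move=> f fd; rewrite !f0//; exact: cvg_cst.
by exists 0; split => //; exists 0%N.
Qed.

Hypothesis half_lt : forall e : K, 0 < e -> \forall i \near \oo, (2^-1 : K) ^+ i < e.

(** The orbit meets every weak neighbourhood of every [d j], and the [d j] are
weakly dense because norm convergence implies weak convergence. *)
Lemma weakly_hypercyclic_of_subsequences (d : nat -> X) (x : X)
    (d_dense : forall y e, 0 < e -> exists j, `|d j - y| < e)
    (sub : forall j, exists q : nat -> nat, forall f, dual_space X f ->
       f (iter (q i) T x) @[i --> \oo] --> f (d j)) :
  weakly_hypercyclic T.
Proof.
exists x => O [p0 Op] oO; pose p : X := p0.
have /choice[j jP] : forall i, exists j, `|d j - p| < 2^-1 ^+ i.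
  by move=> i; apply: d_dense; rewrite exprn_gt0// invr_gt0.
have djp : d (j i) @[i --> \oo] --> p.
  apply/cvgrPdist_lt => e /half_lt; apply: filterS => i.
  by rewrite distrC; exact/lt_trans/jP.
have [|i Odi] := weak_open_meets _ (d \o j) _ oO Op.
  by move=> f [_ cf]; exact: (cvg_comp _ _ djp (cf p)).
have [q qP] := sub (j i).
have [//|k Ok] := weak_open_meets _ (fun k => iter (q k) T x) _ oO Odi.
by exists (iter (q k) T x); split => //; exists (q k).
Qed.

Lemma vanish_of_dense (A : set X) (g : X -> K) (L : K) :
  dense A -> 0 < L -> (forall x y, g (x - y) = g x - g y) ->
  (forall x, `|g x| <= L * `|x|) -> (forall a, A a -> g a = 0) ->
  forall x, g x = 0.
Proof.
move=> dA L0 gB gL gA x; apply/eqP/negPn/negP => gx0.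
have e0 : 0 < `|g x| / L by rewrite divr_gt0// normr_gt0.
have [a Aa ax] := dense_norm_approx _ x _ dA e0.
have := gL (a - x); rewrite gB gA// sub0r normrN mulrC.
by rewrite -ler_pdivrMr// => /le_lt_trans/(_ ax); rewrite ltxx.
Qed.

(** If [n k = p] for infinitely many [k], then for [f] in the dual, [f (T^p y)] is
a limit of terms infinitely many of which are equal to it, so it is 0 on [Y] and
then everywhere. Along the same indices [T^(n k) (S (n k) z)] has image 0 under
[f] and converges to [z], so [f] is 0 on [Z] and then everywhere. *)
Lemma times_unbounded_or_zero_dual (Y Z : set X) (n : nat -> nat)
    (S : nat -> Z -> X) :
  bounded_operator T -> dense Y -> dense Z ->
  (forall y, Y y -> forall f, dual_space X f ->
     f (iter (n k) T y) @[k --> \oo] --> (0 : K^o)) ->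
  (forall z : Z, iter (n k) T (S (n k) z) @[k --> \oo] --> \val z) ->
  (forall p, \forall k \near \oo, (p < n k)%N) \/
  (forall f, dual_space X f -> forall x, f x = 0).
Proof.
move=> /bounded_operator_iter[C C1 TC] dY dZ Yweak Zrec.
have C0 m : 0 < C ^+ m by rewrite exprn_gt0// (lt_le_trans ltr01).
have [avoid|] := pselect (forall p, \forall k \near \oo, n k != p).
  left; elim=> [|p IH].
    by apply: filterS (avoid 0%N) => k; rewrite lt0n.
  apply: filterS (filterI IH (avoid p.+1)) => k /= [pk pk1].
  by rewrite ltn_neqAle eq_sym pk1.
move=> /existsNP[p often]; right=> f fd.
have meet A : (\forall k \near \oo, A k) -> exists2 k, A k & n k = p.
  move=> nA; apply: contrapT => no; apply: often.
  by apply: filterS nA => k Ak; apply/negP => /eqP nk; apply: no; exists k.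
have small0 (a : K) : (forall e, 0 < e -> `|a| < e) -> a = 0.
  move=> ae; apply/eqP/negPn/negP; rewrite -normr_gt0 => /ae.
  by rewrite ltxx.
have [c c0 cf] := dual_space_scaled _ fd.
have cfB x y : c * f (x - y) = c * f x - c * f y.
  by rewrite (dual_spaceB _ fd) mulrBr.
have cfle x : `|c * f x| <= `|x| by exact: dual_unit_ball_le _ x cf.
have cancel_c (a : K) : c * a = 0 -> a = 0.
  by move=> /eqP; rewrite mulf_eq0 gt_eqF//= => /eqP.
have fTp x : f (iter p T x) = 0.
  apply: cancel_c; apply: (vanish_of_dense _ (fun x => c * f (iter p T x)) _ dY (C0 p)).
  - by move=> y z; rewrite iterB cfB.
  - by move=> y; exact: le_trans (cfle _) (TC _ _).
  move=> y Yy; rewrite (small0 (f _)) ?mulr0// => e e0.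
  have /cvgr0Pnorm_lt/(_ e e0)/meet[k /= fk nk] := Yweak y Yy f fd.
  by rewrite -nk.
move=> x; apply: cancel_c; apply: (vanish_of_dense _ (fun x => c * f x) _ dZ ltr01) => //.
  by move=> y; rewrite mul1r.
move=> z Zz; rewrite (small0 (f z)) ?mulr0// => e e0.
have := cvg_comp _ _ (Zrec (SigSub (mem_set Zz))) (fd.2 z).
move=> /cvgrPdist_lt/(_ e e0)/meet[k /= + nk].
by rewrite /= nk fTp subr0.
Qed.

End Orbits.

(** * Construction of the vector *)

Section Construction.
Context {K : numFieldType} {X : completeNormedModType K}.
Variables (T : {linear X -> X}) (C : K).
Hypotheses (C1 : 1 <= C) (TC : forall m x, `|iter m T x| <= C ^+ m * `|x|).
Variables (Y Z : set X) (M : nat) (n : nat -> nat) (S : nat -> Z -> X).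
Hypotheses (dY : dense Y) (dZ : dense Z).
Hypothesis n_infty : forall p, \forall k \near \oo, (p < n k)%N.
Hypothesis Yweak : forall y, Y y -> forall f, dual_space X f ->
  f (iter (n k) T y) @[k --> \oo] --> (0 : K^o).
Hypothesis Ybound : forall y, Y y -> `|y| <= 1 ->
  \forall k \near \oo, `|iter (n k) T y| <= M%:R.
Hypothesis S0 : forall z, S k z @[k --> \oo] --> (0 : X).
Hypothesis TS : forall z, iter (n k) T (S (n k) z) @[k --> \oo] --> \val z.
Variable phi : nat -> X -> K^o.
Hypothesis phi_ball : forall l, dual_unit_ball X (phi l).

Lemma expC_gt0 m : 0 < C ^+ m.
Proof. by rewrite exprn_gt0// (lt_le_trans ltr01). Qed.

(** With [m' = n_k] for a large [k], [y'] is a point of [Y] very near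
[y + S_(m') z], where [z] in [Z] is near [v]. The closeness of [y'] is fixed after
[m'], and so can absorb the factor [C ^+ m']. *)
Lemma approximation_step (y v : X) (e : K) (L m : nat) :
  Y y -> `|y| <= 1 -> 0 < e ->
  exists y' m', [/\ Y y' /\ `|y' - y| <= e, (m <= m')%N,
    `|iter m' T y| <= M%:R,
    forall l, (l <= L)%N -> `|phi l (iter m' T y)| <= e &
    `|iter m' T (y' - y) - v| <= e].
Proof.
move=> Yy y1 e0.
have e3 : 0 < e / 3 by rewrite divr_gt0.
have e2 : 0 < e / 2 by rewrite divr_gt0.
have [z Zz zv] := dense_norm_approx _ v _ dZ e3.
pose z' : Z := SigSub (mem_set Zz).
have phi_small : \forall k \near \oo, forall l, (l <= L)%N ->
    `|phi l (iter (n k) T y)| <= e.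
  have : \forall k \near \oo, forall l : 'I_L.+1, `|phi l (iter (n k) T y)| <= e.
    apply: filter_forall => l.
    have /cvgr0Pnorm_lt/(_ e e0) := Yweak y Yy _ (phi_ball l).1.
    by apply: filterS => k; exact: ltW.
  by apply: filterS => k kP l lL; exact: (kP (Ordinal (lL : (l < L.+1)%N))).
have S_small : \forall k \near \oo, `|S (n k) z'| < e / 2.
  have /cvgr0Pnorm_lt/(_ _ e2)[N _ NP] := S0 z'.
  apply: filterS (n_infty N) => k Nk; apply: NP; exact: ltnW.
have TS_close : \forall k \near \oo, `|z - iter (n k) T (S (n k) z')| < e / 3.
  by have /cvgrPdist_lt/(_ _ e3) := TS z'.
have [k [[[[mk yM] ph] Sk] TSk]] := filter_ex (filterI (filterI (filterI (filterI
  (n_infty m) (Ybound y Yy y1)) phi_small) S_small) TS_close).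
have e3C : 0 < e / 3 / C ^+ n k by rewrite divr_gt0// expC_gt0.
have [y' Yy' yy'] := dense_norm_approx _ (y + S (n k) z') _ dY e3C.
have C1n : 1 <= C ^+ n k by rewrite exprn_ege1.
exists y', (n k); split => //; last 1 first.
- have -> : iter (n k) T (y' - y) - v = iter (n k) T (y' - (y + S (n k) z')) +
      (iter (n k) T (S (n k) z') - z) + (z - v).
    by rewrite opprD [y' + (_ - _)]addrA (iterB T _ (y' - y)) !addrA !subrK.
  rewrite (_ : e = e / 3 + e / 3 + e / 3); last by field.
  apply: le_trans (ler_normD _ _) _; apply: lerD; last exact: ltW.
  apply: le_trans (ler_normD _ _) _; apply: lerD; last by rewrite distrC ltW.
  apply: le_trans (TC _ _) _.
  by rewrite mulrC -ler_pdivlMr ?expC_gt0// ltW.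
- split=> //.
  have -> : y' - y = y' - (y + S (n k) z') + S (n k) z'.
    by rewrite opprD addrA subrK.
  rewrite [e]splitr; apply: le_trans (ler_normD _ _) _.
  apply: lerD; last exact: ltW.
  apply/ltW/(lt_le_trans yy').
  rewrite ler_pdivrMr ?expC_gt0//.
  apply: (@le_trans _ _ (e / 2)); last by rewrite ler_peMr// ltW.
  by rewrite ler_pM2l// lef_pV2 ?posrE// ler_nat.
- exact: ltnW.
Qed.

Hypothesis half_lt : forall e : K, 0 < e -> \forall i \near \oo, (2^-1 : K) ^+ i < e.

(** Iterating the step. The increment at stage [i] is at most [C^-m_i 2^-(i+2)]: the
first factor keeps its images under the first [i] exponents small, the second
leaves all [x_i] in the unit ball, where the uniform bound [M] applies. *)
Lemma approximating_sequence (v : nat -> X) :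
  exists (x : nat -> X) (m : nat -> nat),
    [/\ {homo m : i j / (i <= j)%N},
      forall i, `|x i.+1 - x i| <= (C ^+ m i)^-1 * 2^-1 ^+ i.+2,
      forall i, `|iter (m i.+1) T (x i)| <= M%:R,
      forall i l, (l <= i)%N -> `|phi l (iter (m i.+1) T (x i))| <= 2^-1 ^+ i &
      forall i, `|iter (m i.+1) T (x i.+1 - x i) - v i| <= 2^-1 ^+ i].
Proof.
pose eps i m : K := (C ^+ m)^-1 * 2^-1 ^+ i.+2.
pose admissible i (s : X * nat) := Y s.1 /\ `|s.1| <= 1 - 2^-1 ^+ i.+1.
pose linked i (s s' : X * nat) := [/\ Y s'.1 /\ `|s'.1 - s.1| <= eps i s.2,
  (s.2 <= s'.2)%N, `|iter s'.2 T s.1| <= M%:R,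
    forall l, (l <= i)%N -> `|phi l (iter s'.2 T s.1)| <= eps i s.2 &
    `|iter s'.2 T (s'.1 - s.1) - v i| <= eps i s.2].
have eps_gt0 i m : 0 < eps i m by rewrite mulr_gt0 ?half_expn_gt0// invr_gt0 expC_gt0.
have eps_le i m : eps i m <= 2^-1 ^+ i.+2.
  rewrite ler_piMl ?(ltW (half_expn_gt0 K _))// invf_le1 ?expC_gt0//.
  exact: exprn_ege1.
have /choice[next nextP] : forall p : nat * (X * nat), exists s',
    admissible p.1 p.2 -> linked p.1 p.2 s'.
  move=> [i [y m]].
  have [[/= Yy y1]|nadm] := pselect (admissible i (y, m)); last by exists (y, m).
  have [||y' [m' link]] := approximation_step y (v i) (eps i m) i m Yy.
  - by apply: le_trans y1 _; rewrite lerBlDr lerDl ltW// half_expn_gt0.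
  - exact: eps_gt0.
  - by exists (y', m').
have [y0 Yy0 y00] := dense_norm_approx _ 0 _ dY (half_expn_gt0 K 1).
pose s := fix s i := if i is j.+1 then next (j, s j) else (y0, 0%N).
(* The margin [2^-(i+1)] below norm 1 pays for all later increments. *)
have sadm i : admissible i (s i).
  elim: i => [|i IH].
    split=> //=; rewrite subr0 in y00.
    by rewrite expr1 in y00 *; apply/ltW; rewrite [1 - _](_ : _ = 2^-1)//; field.
  have [[Ys' ss'] _ _ _ _] := nextP (i, s i) IH; split => //.
  rewrite -[X in `|X|](subrK (s i).1).
  apply: le_trans (ler_normD _ _) _.
  apply: le_trans (lerD (le_trans ss' (eps_le _ _)) IH.2) _.
  by rewrite (half_expnS K i.+1) opprD addrCA subrKC lexx.
have slink i : linked i (s i) (s i.+1) := nextP (i, s i) (sadm i).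
have eps_half i m : eps i m <= 2^-1 ^+ i.
  by apply: le_trans (eps_le _ _) (half_expn_le K _ _ _); rewrite -addn2 leq_addr.
exists (fun i => (s i).1), (fun i => (s i).2); split=> [|i|i|i l li|i].
- apply: homo_leq => [//|j i k|i]; first exact: leq_trans.
  by have [] := slink i.
- by have [[]] := slink i.
- by have [] := slink i.
- by have [_ _ _ /(_ l li)/le_trans + _] := slink i; exact.
- by have [_ _ _ _ /le_trans] := slink i; exact.
Qed.

(** The limit of the [x_i]. Its distance to [x_i] is at most [C^-m_i 2^-i], so that
[T^(m_(i+1)) x] is as good as [T^(m_(i+1)) x_(i+1)], which splits into the weakly
small [T^(m_(i+1)) x_i] and the approximation of [v i]. *)
Lemma weakly_approximating_orbit (v : nat -> X) :
  exists (x : X) (q : nat -> nat),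
    (forall i, `|iter (q i) T x - v i| <= (M + 2)%:R) /\
    (forall l i, (l <= i)%N ->
       `|phi l (iter (q i) T x - v i)| <= 3 * 2^-1 ^+ i).
Proof.
have [x [m [m_le xS Tx phix Tv]]] := approximating_sequence v.
have C0 i : 0 < (C ^+ m i)^-1 by rewrite invr_gt0 expC_gt0.
(* The increments after stage [i] carry a factor [C^-m_j <= C^-m_i]. *)
have tail i j : (i <= j)%N ->
    `|x j - x i| <= (C ^+ m i)^-1 * (2^-1 ^+ i.+1 - 2^-1 ^+ j.+1).
  move=> /subnK <-; elim: (j - i)%N => [|k IH].
    by rewrite !subrr mulr0 normr0.
  rewrite addSn -(subrK (x (k + i)%N) (x _.+1)) -addrA.
  apply: le_trans (ler_normD _ _) _.
  apply: le_trans (lerD (xS _) IH) _.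
  apply: (@le_trans _ _ ((C ^+ m i)^-1 * 2^-1 ^+ (k + i).+2 +
      (C ^+ m i)^-1 * (2^-1 ^+ i.+1 - 2^-1 ^+ (k + i).+1))).
    rewrite lerD2r ler_pM2r ?half_expn_gt0// lef_pV2 ?posrE ?expC_gt0//.
    by rewrite ler_weXn2l// m_le// leq_addl.
  by rewrite -mulrDr (half_expnS K (k + i).+1) opprD addrCA subrKC lexx.
have x_cvg : cvg (x @ \oo).
  apply/cauchy_cvgP/cauchy_exP => e /half_lt[i _ /(_ i (leqnn i))/= ie].
  exists (x i); exists i => // j /= ij; rewrite -ball_normE /= distrC.
  apply: le_lt_trans (tail _ _ ij) _; apply: le_lt_trans ie.
  apply: (@le_trans _ _ (1 * 2^-1 ^+ i)); last by rewrite mul1r.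
  apply: ler_pM; rewrite ?(ltW (C0 _))//.
  - by rewrite subr_ge0 half_expn_le.
  - by rewrite invf_le1 ?expC_gt0// exprn_ege1.
  - by rewrite lerBlDr (half_expnS K i) -addrA lerDl addr_ge0// ltW// half_expn_gt0.
have lim_tail i : `|limn x - x i| <= (C ^+ m i)^-1 * 2^-1 ^+ i.
  have c0 : 0 < (C ^+ m i)^-1 * 2^-1 ^+ i.+1 by rewrite mulr_gt0// half_expn_gt0.
  have /cvgrPdist_lt/(_ _ c0)[N _ NP] := x_cvg.
  have xN := NP _ (leq_maxl N i).
  rewrite -(subrK (x (maxn N i)) (limn x)) -addrA.
  apply: le_trans (ler_normD _ _) _.
  rewrite (half_expnS K i) mulrDr; apply: lerD; first exact: ltW.
  apply: le_trans (tail _ _ (leq_maxr N i)) _.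
  by rewrite ler_pM2l// gerBl ltW// half_expn_gt0.
(* The norm-small part; what is left, [T^(m_(i+1)) x_i], is only weakly small. *)
pose r i := iter (m i.+1) T (limn x) - v i - iter (m i.+1) T (x i).
have r_le i : `|r i| <= 2 * 2^-1 ^+ i.
  have -> : r i = iter (m i.+1) T (limn x - x i.+1) +
      (iter (m i.+1) T (x i.+1 - x i) - v i).
    by rewrite /r !iterB addrA [in RHS]addrA subrK addrAC.
  rewrite mulrDl mul1r; apply: le_trans (ler_normD _ _) _; apply: lerD => //.
  apply: le_trans (TC _ _) _.
  apply: le_trans (ler_wpM2l (ltW (expC_gt0 _)) (lim_tail _)) _.
  by rewrite mulrA mulfV ?gt_eqF ?expC_gt0// mul1r half_expn_le.
have split_r i : iter (m i.+1) T (limn x) - v i = iter (m i.+1) T (x i) + r i.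
  by rewrite subrKC.
exists (limn x), (m \o succn); split=> [i|l i li] /=; rewrite split_r.
  rewrite natrD; apply: le_trans (ler_normD _ _) _; apply: lerD => //.
  apply: le_trans (r_le i) _; rewrite ler_piMr//.
  by have := half_expn_le K _ _ (leq0n i); rewrite expr0.
rewrite (dual_spaceD _ (phi_ball l).1); apply: le_trans (ler_normD _ _) _.
rewrite (_ : 3 * _ = 2^-1 ^+ i + 2 * 2^-1 ^+ i); last by ring.
apply: lerD; first exact: phix.
exact: le_trans (dual_unit_ball_le _ _ (phi_ball l)) (r_le i).
Qed.
End Construction.

(** * The criterion *)

(** The 2-adic valuation of [i.+1] takes each value infinitely often: it schedules
the targets. *)
Lemma logn2_recurrent (a : nat) : exists g : nat -> nat,
  (forall k, (k <= g k)%N) /\ (forall k, logn 2 (g k).+1 = a).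
Proof.
pose g k := (2 ^ a * k.*2.+1).-1%N.
have gS k : (g k).+1 = (2 ^ a * k.*2.+1)%N.
  by rewrite prednK// muln_gt0 expn_gt0.
exists g; split=> k.
  rewrite -ltnS gS; apply: (@leq_trans k.*2.+1); last by rewrite leq_pmull// expn_gt0.
  by rewrite ltnS -addnn leq_addr.
rewrite gS lognM ?expn_gt0// lognX logn_prime// eqxx muln1.
by rewrite lognE dvdn2 /= odd_double addn0.
Qed.

Theorem theorem2p1 (R : realType) (s : scalars)
  (X : completeNormedModType (scalar_field R s))
  (X_reflexive : reflexive_space X) (X_separable : separable_space X)
  (T : {linear X -> X}) (T_bounded : bounded_operator T)
  (Y Z : set X) (Y_dense : dense Y) (Z_dense : dense Z)
  (n : nat -> nat) (n_gt0 : forall k, (1 <= k)%N -> (0 < n k)%N)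
  (M : nat) (M_gt0 : (0 < M)%N)
  (cond1 : forall y : X, Y y ->
     (iter (n k) T y : weak_space X) @[k --> \oo] --> ((0 : X) : weak_space X))
  (cond2 : forall y : X, Y y -> `|y| <= 1 ->
     exists2 N : nat, (1 <= N)%N &
       forall k, (N <= k)%N -> `|iter (n k) T y| <= M%:R)
  (cond3 : exists S : nat -> Z -> X,
     (forall k, (1 <= k)%N -> linear_on_subset (S k)) /\
     (forall z : Z,
        S k z @[k --> \oo] --> (0 : X) /\
        iter (n k) T (S (n k) z) @[k --> \oo] --> \val z)) :
  weakly_hypercyclic T.
Proof.
have Yweak y : Y y -> forall f, dual_space X f ->
    f (iter (n k) T y) @[k --> \oo] --> (0 : (scalar_field R s)^o).
  move=> Yy f fd; have /weak_cvgP/(_ f fd) := cond1 y Yy.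
  by rewrite (dual_space0 _ fd).
have [S [_ SP]] := cond3.
have [|n_infty|f0] := times_unbounded_or_zero_dual T Y Z n S T_bounded Y_dense Z_dense Yweak.
- by move=> z; exact: (SP z).2.
- have [C C1 TC] := bounded_operator_iter T T_bounded.
  have [d d_dense] := separable_dense_sequence X_separable.
  have half := half_expn_lt R s.
  have [phi [phi_ball phi_det]] := countable_dual_family half d d_dense.
  have Ybound y : Y y -> `|y| <= 1 ->
      \forall k \near \oo, `|iter (n k) T y| <= M%:R.
    by move=> Yy /(cond2 y Yy)[N _ NP]; exists N.
  have [x [q [w_bound w_phi]]] := weakly_approximating_orbit T C C1 TC Y Z M n S
    Y_dense Z_dense n_infty Yweak Ybound (fun z => (SP z).1) (fun z => (SP z).2)
    phi phi_ball half (fun i => d (logn 2 i.+1)).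
  apply: (weakly_hypercyclic_of_subsequences T half d x d_dense) => a.
  have [g [g_ge ga]] := logn2_recurrent a.
  (* Along [g] the target is constantly [d a]. *)
  exists (q \o g) => f fd.
  pose w i := iter (q i) T x - d (logn 2 i.+1).
  have phiw l : phi l (w i) @[i --> \oo] --> (0 : (scalar_field R s)^o).
    apply/cvgr0Pnorm_lt => e e0.
    have e3 : 0 < e / 3 by rewrite divr_gt0.
    apply: filterS (filterI (half _ e3) (nbhs_infty_ge l)) => i /= [ie li].
    by apply: le_lt_trans (w_phi l i li) _; rewrite mulrC -ltr_pdivlMr.
  have fw := bounded_weak_cvg0 (ultra_cvg R s) X_reflexive phi phi_det
    (fun l => (phi_ball l).1) w _ w_bound phiw f fd.
  have g_infty : g k @[k --> \oo] --> \oo.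
    by move=> A [N _ NA]; exists N => // k Nk; apply: NA; exact: leq_trans (g_ge k).
  have := cvg_comp _ _ g_infty fw.
  move=> /cvgr0Pnorm_lt fwg; apply/cvgrPdist_lt => e /fwg.
  apply: filterS => k; rewrite /= /w ga (dual_spaceB _ fd).
  by rewrite distrC.
- exact: zero_dual_weakly_hypercyclic.
Qed.
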